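(* Let $n\ge 2$ and let $K, L$ be compact convex subsets of $\mathbb{R}^n$. Suppose that, for every unit vector $u\in\mathbb{R}^n$, the orthogonal projection $L_u$ contains a translate of the orthogonal projection $K_u$. Then $V_n(K) \leq n V_n(L)$.
   Context: For a unit vector $u$, $K_u$ denotes the orthogonal projection of $K$ onto the hyperplane $u^\perp$. $V_n$ is $n$-dimensional volume. Compact convex sets are nonempty. *)

(* Defs.v *)
From HB Require Import structures.
From mathcomp Require Import all_boot all_order all_algebra.
From mathcomp Require Import all_classical all_reals all_analysis.

Set Implicit Arguments.
Unset Strict Implicit.
Unset Printing Implicit Defensive.

Import Order.TTheory GRing.Theory Num.Theory.
Import numFieldNormedType.Exports.

Local Open Scope classical_set_scope.
Local Open Scope ring_scope.

(** [R^n] is ['rV[R]_n] with its library topology.  The library norm on it is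
    the sup norm, so the Euclidean norm is defined here. *)

Definition dotv (R : realType) (n : nat) (x y : 'rV[R]_n) : R :=
  \sum_(i < n) x 0 i * y 0 i.

Definition enorm (R : realType) (n : nat) (x : 'rV[R]_n) : R :=
  Num.sqrt (dotv x x).

(** The orthogonal projection onto the hyperplane orthogonal to [u], provided
    [enorm u = 1]. *)
Definition proj_hyper (R : realType) (n : nat) (u x : 'rV[R]_n) : 'rV[R]_n :=
  x - dotv x u *: u.

Definition shadow (R : realType) (n : nat) (u : 'rV[R]_n)
    (K : set 'rV[R]_n) : set 'rV[R]_n :=
  proj_hyper u @` K.

Definition contains_translate (R : realType) (n : nat)
    (B A : set 'rV[R]_n) : Prop :=
  exists v : 'rV[R]_n, [set a + v | a in A] `<=` B.

(** The library has binary products of measures but no [n]-fold power, so the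
    [n]-dimensional Lebesgue measure is the iterated product of [n] copies of
    the one-dimensional one.  Like the library's product, it is meaningful on
    measurable (here Borel) sets only; compact sets are Borel. *)
Fixpoint lebesgue_tuple (R : realType) (n : nat) :
    set (n.-tuple (measurableTypeR R)) -> \bar R :=
  match n with
  | 0 => dirac [tuple]
  | m.+1 => pushforward (lebesgue_measure \x @lebesgue_tuple R m)%E
              (fun p => [tuple of p.1 :: p.2])
  end.

Definition vol (R : realType) (n : nat) (A : set 'rV[R]_n) : \bar R :=
  lebesgue_tuple [set t : n.-tuple (measurableTypeR R) |
    A (\row_(i < n) (tnth t i : R))].

(* Main.v *)
Require Import Defs.
From HB Require Import structures.
From mathcomp Require Import all_boot all_order all_algebra finmap.
From mathcomp Require Import ring lra.
From mathcomp Require Import all_classical all_reals all_analysis.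
From mathcomp Require Import measurable_realfun.

(** Write a point of R^(m+1) as (s, y) and let D be the length of the longest
    chord of K in the direction of the first axis; K', L' denote the projections
    along that axis.  Shadows determine widths, so K - K is contained in L - L
    and L has a chord of length D over some point y0.  Tonelli along the axis
    gives vol K <= D vol K' <= D vol L'.  On the other hand, by convexity the
    chord of L over s y0 + (1 - s) z has length at least s D for every z in L',
    so Tonelli applied to the cone {(s, s y0 + (1 - s) z)} gives
    D vol L' / (m + 1) <= vol L. *)

Set Implicit Arguments.
Unset Strict Implicit.
Unset Printing Implicit Defensive.

Import Order.TTheory GRing.Theory Num.Theory.
Import numFieldNormedType.Exports.

Local Open Scope classical_set_scope.
Local Open Scope ring_scope.

(** * Lebesgue measure on tuples *)

(** Names the map of the recursive clause of [lebesgue_tuple], so that its measurability can be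
    stated and reused. *)
Definition tcons (R : realType) (m : nat)
    (p : measurableTypeR R * m.-tuple (measurableTypeR R)) :
  m.+1.-tuple (measurableTypeR R) := [tuple of p.1 :: p.2].

Lemma measurable_tcons (R : realType) (m : nat) :
  measurable_fun [set: measurableTypeR R * m.-tuple (measurableTypeR R)]
    (@tcons R m).
Proof. exact: measurable_cons. Qed.

Definition tuncons (R : realType) (m : nat)
    (t : m.+1.-tuple (measurableTypeR R)) :
  measurableTypeR R * m.-tuple (measurableTypeR R) :=
  (thead t, [tuple of behead t]).

Lemma measurable_tuncons (R : realType) (m : nat) :
  measurable_fun setT (@tuncons R m).
Proof.
apply/measurable_fun_pairP; split.
  exact: measurable_tnth.
exact: measurable_behead.
Qed.

Lemma tuncons_tcons (R : realType) (m : nat) :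
  cancel (@tcons R m) (@tuncons R m).
Proof. by move=> [x t]; rewrite /tuncons theadE; congr pair; apply: val_inj. Qed.


Section tcons_measure.
Variables (R : realType) (m : nat).
Variable mu : {sigma_finite_measure
  set (m.-tuple (measurableTypeR R)) -> \bar R}.

(** The successor clause of [lebesgue_tuple] over an arbitrary sigma-finite [mu], so that it can
    serve as an induction step before [lebesgue_tuple] is known to be a measure. *)
Definition tcons_measure : set (m.+1.-tuple (measurableTypeR R)) -> \bar R :=
  pushforward (lebesgue_measure \x mu)%E (@tcons R m).

Let push : {measure set (m.+1.-tuple (measurableTypeR R)) -> \bar R} :=
  measure_function_pushforward__canonical__measure_function_Measure
    (lebesgue_measure \x mu)%E (@measurable_tcons R m).

HB.instance Definition _ := isMeasure.Build _ _ _ tcons_measure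
  (@measure0 _ _ _ push) (@measure_ge0 _ _ _ push)
  (@measure_semi_sigma_additive _ _ _ push).

Let sigma_finite_tcons_measure : sigma_finite setT tcons_measure.
Proof.
have /sigma_finiteP[F [FT ndF Foo]] := sigma_finiteT (@lebesgue_measure R).
have /sigma_finiteP[G [GT ndG Goo]] := sigma_finiteT mu.
(* Both exhaustions are nondecreasing, so the larger of two indices works for both coordinates and
   the diagonal boxes cover. *)
exists (fun n => @tuncons R m @^-1` (F n `*` G n)).
  rewrite -preimage_bigcup; apply/esym/seteqP; split => // t _.
  have : setT (tuncons t).1 by [].
  have : setT (tuncons t).2 by [].
  rewrite FT GT => -[k _ Gk] [l _ Fl]; exists (maxn k l) => //; split.
    by move: Fl; apply/subsetPset/ndF/leq_maxr.
  by move: Gk; apply/subsetPset/ndG/leq_maxl.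
move=> n; have [mF Fn] := Foo n; have [mG Gn] := Goo n; split.
  by rewrite -[X in measurable X]setTI; apply: measurable_tuncons => //;
    exact: measurableX.
rewrite /tcons_measure /pushforward (_ : _ @^-1` _ = F n `*` G n).
  by rewrite product_measure1E// lte_mul_pinfty// ge0_fin_numE.
by apply/funext => p; rewrite /preimage /mkset tuncons_tcons.
Qed.

HB.instance Definition _ := Measure_isSigmaFinite.Build _ _ _ tcons_measure
  sigma_finite_tcons_measure.
End tcons_measure.

(** Additivity and sigma-finiteness go through one induction together, because the product
    construction asks for a sigma-finite second factor at every stage. *)
Lemma lebesgue_tuple_measure (R : realType) (n : nat) :
  exists mu : {sigma_finite_measure
      set (n.-tuple (measurableTypeR R)) -> \bar R},
    (mu : set _ -> \bar R) = @lebesgue_tuple R n.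
Proof.
elim: n => [|m [mu muE]].
  by exists (dirac [tuple] : {sigma_finite_measure
    set (0.-tuple (measurableTypeR R)) -> \bar R}).
exists (tcons_measure mu : {sigma_finite_measure set _ -> \bar R}).
by rewrite /= -muE.
Qed.

Section lebesgue_tuple_instances.
Variables (R : realType) (n : nat).

Let lebesgue_tuple0 : @lebesgue_tuple R n set0 = 0%E.
Proof. by have [mu <-] := lebesgue_tuple_measure R n; exact: measure0. Qed.

Let lebesgue_tuple_ge0 A : (0 <= @lebesgue_tuple R n A)%E.
Proof. by have [mu <-] := lebesgue_tuple_measure R n; exact: measure_ge0. Qed.

Let lebesgue_tuple_sigma_additive : semi_sigma_additive (@lebesgue_tuple R n).
Proof.
have [mu <-] := lebesgue_tuple_measure R n.
exact: measure_semi_sigma_additive.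
Qed.

HB.instance Definition _ := isMeasure.Build _ _ _ (@lebesgue_tuple R n)
  lebesgue_tuple0 lebesgue_tuple_ge0 lebesgue_tuple_sigma_additive.

Let lebesgue_tuple_sigma_finite : sigma_finite setT (@lebesgue_tuple R n).
Proof.
by have [mu <-] := lebesgue_tuple_measure R n; exact: sigma_finiteT.
Qed.

HB.instance Definition _ := Measure_isSigmaFinite.Build _ _ _
  (@lebesgue_tuple R n) lebesgue_tuple_sigma_finite.
End lebesgue_tuple_instances.

(** The right side is a measure in [A] that agrees with Lebesgue measure on half-open intervals, so
    uniqueness applies. *)
Lemma lebesgue_measure_affine (R : realType) (s v : R) (A : set R) :
  0 < s -> measurable (A : set (measurableTypeR R)) ->
  lebesgue_measure A =
  (s%:E * lebesgue_measure ((fun x => s * x + v)%R @^-1` A))%E.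
Proof.
move=> s0 mA.
have mf : measurable_fun setT
    (fun x : measurableTypeR R => s * x + v : measurableTypeR R).
  by apply: measurable_funD => //; exact: measurable_funM.
pose nu : {measure set (measurableTypeR R) -> \bar R} :=
  measure_function_pushforward__canonical__measure_function_Measure
    (@lebesgue_measure R) mf.
have -> : (s%:E * lebesgue_measure ((fun x => s * x + v)%R @^-1` A))%E =
  mscale (NngNum (ltW s0)) nu A by [].
apply: lebesgue_measure_unique => // _ [[a b] _ <-].
pose I : set (measurableTypeR R) := `](a - v) / s, (b - v) / s]%classic.
transitivity (s%:E * lebesgue_measure I)%E.
  rewrite /I !lebesgue_measure_itv/= !lte_fin ltr_pM2r ?invr_gt0// ltrD2r.
  case: ifPn => _; last by rewrite mule0.
  rewrite -!EFinB -EFinM -mulrBl mulrC divfK ?gt_eqF//.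
  by congr EFin; rewrite opprB addrA subrK.
rewrite /mscale /nu /= /pushforward; congr (_ * lebesgue_measure _)%E.
apply/funext => x; apply/propext; rewrite /I /preimage /= !in_itv/=.
by rewrite ltr_pdivrMr// ler_pdivlMr// ltrBlDr lerBrDr mulrC.
Qed.

Definition taffine (R : realType) (n : nat) (s : R)
    (v t : n.-tuple (measurableTypeR R)) : n.-tuple (measurableTypeR R) :=
  [tuple (s * tnth t i + tnth v i : measurableTypeR R) | i < n].

Lemma measurable_taffine (R : realType) (n : nat) (s : R)
  (v : n.-tuple (measurableTypeR R)) : measurable_fun setT (taffine s v).
Proof.
apply/measurable_fun_tnthP => i.
rewrite (_ : _ \o _ = fun t => s * tnth t i + tnth v i :> R).
  apply: measurable_funD => //; apply: measurable_funM => //.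
  exact: measurable_tnth.
by apply/funext => t /=; rewrite tnth_mktuple.
Qed.

(** Induction on the dimension: on rectangles the factors [s] and [s ^+ m] come from the two
    coordinates of [tcons], and a product measure is determined by its values on rectangles. *)
Lemma lebesgue_tuple_affine (R : realType) (n : nat) (s : R)
    (v : n.-tuple (measurableTypeR R)) A : 0 < s -> measurable A ->
  lebesgue_tuple A = ((s ^+ n)%:E * lebesgue_tuple (taffine s v @^-1` A))%E.
Proof.
move=> s0; elim: n v A => [|m IH] v A mA.
  rewrite expr0 mul1e; congr lebesgue_tuple; apply/funext => t.
  by rewrite /preimage /mkset (tuple0 t) (tuple0 (taffine _ _ _)).
pose f (x : measurableTypeR R) : measurableTypeR R := s * x + thead v.
pose g := taffine s [tuple of behead v].
pose h (p : measurableTypeR R * m.-tuple (measurableTypeR R)) := (f p.1, g p.2).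
have mf : measurable_fun setT f.
  by apply: measurable_funD => //; exact: measurable_funM.
have mg : measurable_fun setT g by exact: measurable_taffine.
have mh : measurable_fun setT h.
  by apply: measurable_fun_pair; exact: measurableT_comp.
pose la := (@lebesgue_measure R \x @lebesgue_tuple R m)%E.
pose nu : {measure
    set (measurableTypeR R * m.-tuple (measurableTypeR R)) -> \bar R} :=
  measure_function_pushforward__canonical__measure_function_Measure la mh.
have sm0 : 0 <= s ^+ m.+1 by apply/ltW/exprn_gt0.
have mB : measurable (@tcons R m @^-1` A).
  by rewrite -[X in measurable X]setTI; exact: measurable_tcons.
transitivity (mscale (NngNum sm0) nu (@tcons R m @^-1` A)); last first.
  rewrite /mscale /nu /= /pushforward; congr (_ * la _)%E.
  apply/funext => -[x t]; apply/propext; rewrite /preimage /mkset /h /=.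
  suff -> : tcons (f x, g t) = taffine s v (tcons (x, t)) by [].
  apply: eq_from_tnth => i; rewrite tnth_mktuple /tcons.
  case: (unliftP ord0 i) => [j|] ->; last by rewrite !tnth0.
  by rewrite !tnthS /g tnth_mktuple [v in RHS]tuple_eta tnthS.
have -> : lebesgue_tuple A = la (@tcons R m @^-1` A) by [].
apply: (@product_measure_unique _ _ _ _ _ (@lebesgue_measure R)
  (@lebesgue_tuple R m) (mscale (NngNum sm0) nu)) => //.
move=> X Y mX mY.
transitivity ((s ^+ m.+1)%:E * la ((f @^-1` X) `*` (g @^-1` Y)))%E => //.
rewrite /la product_measure1E; first last.
- by rewrite -[X in measurable X]setTI; exact: mg.
- by rewrite -[X in measurable X]setTI; exact: mf.
rewrite /= (lebesgue_measure_affine (thead v) s0 mX) (IH [tuple of behead v] Y)//.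
by rewrite exprS EFinM muleACA.
Qed.

(** * Volume *)

Definition rowt (R : realType) (n : nat) (t : n.-tuple (measurableTypeR R)) :
  'rV[R]_n := \row_(i < n) (tnth t i : R).

(** The point (x, v) of R^(m+1), the counterpart of [tcons] on row vectors. *)
Definition consv (R : realType) (m : nat) (x : R) (v : 'rV[R]_m) :
  'rV[R]_m.+1 := \row_(i < m.+1) oapp (v 0) x (unlift ord0 i).

Lemma rowt_tcons (R : realType) (m : nat) (x : measurableTypeR R)
    (t : m.-tuple (measurableTypeR R)) :
  rowt (tcons (x, t)) = consv x (rowt t).
Proof.
apply/rowP => i; rewrite !mxE; case: unliftP => [j|] ->.
  by rewrite /tcons tnthS /= mxE.
by rewrite /tcons tnth0.
Qed.

Definition vmeasurable (R : realType) (n : nat) (A : set 'rV[R]_n) :=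
  measurable [set t : n.-tuple (measurableTypeR R) | A (rowt t)].

(** Slicing at a fixed first coordinate is how the product measure is defined; this order serves the
    lower bound on the cone. *)
Lemma vol_xsection (R : realType) (m : nat) (A : set 'rV[R]_m.+1) :
  vol A = (\int[@lebesgue_measure R]_x vol [set v | A (consv (x : R) v)])%E.
Proof.
rewrite {1}/vol /lebesgue_tuple -/lebesgue_tuple /pushforward /product_measure1.
apply: eq_integral => x _; rewrite /= /vol; congr lebesgue_tuple.
apply/funext => t; apply/propext; rewrite /xsection /= inE /=.
by rewrite -rowt_tcons.
Qed.

Lemma vmeasurable_tcons (R : realType) (m : nat) (A : set 'rV[R]_m.+1) :
  vmeasurable A ->
  measurable [set p : measurableTypeR R * m.-tuple (measurableTypeR R)
    | A (consv p.1 (rowt p.2))].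
Proof.
move=> mA; have := @measurable_tcons R m measurableT _ mA; rewrite setTI.
by congr measurable; apply/funext => -[x t]; rewrite /preimage /mkset rowt_tcons.
Qed.

(** Tonelli along the first axis: the product taken in the other order has the same values on
    rectangles, hence is the same measure. *)
Lemma vol_ysection (R : realType) (m : nat) (A : set 'rV[R]_m.+1) :
  vmeasurable A ->
  vol A = (\int[@lebesgue_tuple R m]_t
    lebesgue_measure [set x : measurableTypeR R | A (consv x (rowt t))])%E.
Proof.
move=> mA; rewrite {1}/vol /lebesgue_tuple -/lebesgue_tuple /pushforward.
rewrite (@product_measure_unique _ _ _ _ _ _ _
  (lebesgue_measure \x^ @lebesgue_tuple R m)%E).
- apply: eq_integral => t _ /=; congr lebesgue_measure.
  apply/funext => x; apply/propext; rewrite /ysection /= inE /=.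
  by rewrite -rowt_tcons.
- by move=> X Y mX mY; exact: product_measure2E.
- have := vmeasurable_tcons mA; congr measurable; apply/funext => -[x t].
  by rewrite /mkset -rowt_tcons.
Qed.

(** A compact set is the intersection over k of finite unions of balls of radius 1/(k+1) centred in
    it. Balls of the sup norm are boxes, which are measurable coordinatewise. *)
Lemma vmeasurable_compact (R : realType) (n : nat) (A : set 'rV[R]_n) :
  compact A -> vmeasurable A.
Proof.
move=> cA; have clA : closed A.
  by apply: compact_closed => //; exact: norm_hausdorff.
have cov (k : nat) : exists D : set 'rV[R]_n,
    [/\ finite_set D, D `<=` A & A `<=` cover D (fun a => ball a k.+1%:R^-1)].
  move: cA; rewrite compact_cover => /(_ _ A (fun a => (ball a k.+1%:R^-1)%R)).
  case.
  - by move=> a _; exact: ball_open.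
  - by move=> a Aa; exists a => //; exact: ballxx.
  - by move=> D DA AD; exists [set` D]; split => // a /DA; rewrite inE.
have [D /all_and3[finD DA AD]] := choice cov.
rewrite /vmeasurable; set S := mkset _.
have -> : S = \bigcap_k \bigcup_(a in D k)
    [set t : n.-tuple (measurableTypeR R) | ball a k.+1%:R^-1 (rowt t)].
  apply/seteqP; split => [t At k _|t At]; first exact: AD.
  apply: clA => B /nbhs_ballP[e /= e0 eB].
  have [k _ ke] := near_infty_natSinv_lt (PosNum e0).
  have [a /= aD ta] := At k I; exists a; split; first exact: DA aD.
  apply: eB; apply: ball_sym; apply: le_ball ta; apply: ltW.
  by apply: ke => /=.
apply: bigcap_measurable => // k _.
apply: fin_bigcup_measurable => //.
move=> a _.
have -> : [set t : n.-tuple (measurableTypeR R) | ball a k.+1%:R^-1 (rowt t)] =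
   \bigcap_(i in [set: 'I_n])
     (@tnth n (measurableTypeR R))^~ i @^-1` (ball (a 0 i) k.+1%:R^-1 : set R).
  apply/seteqP; split => t.
    by move=> [_ h] i _; have := h 0 i; rewrite mxE.
  by move=> h; split => // i j; rewrite ord1 mxE; exact: h.
apply: fin_bigcap_measurable => // i _.
rewrite -[X in measurable X]setTI; apply: measurable_tnth => //.
rewrite ball_itv; exact: measurable_itv.
Qed.

(** * Splitting off the first coordinate *)

Lemma continuous_rV (R : realType) (T : topologicalType) (n : nat)
    (f : T -> 'rV[R]_n) :
  (forall i, continuous (fun t => f t 0 i)) -> continuous f.
Proof.
move=> cf x A [P fP PA].
have : \forall t \near x, forall i, P 0 i (f t 0 i).
  by apply: filter_forall => i; apply: cf; exact: fP.
by apply: filterS => t Pt; apply: PA => i j; rewrite ord1; exact: Pt.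
Qed.

(** The projection along the first axis; K' and L' are the images of K and L under it. *)
Definition tailv (R : realType) (m : nat) (w : 'rV[R]_m.+1) : 'rV[R]_m :=
  \row_j w 0 (lift ord0 j).

Lemma consvK (R : realType) (m : nat) (x : R) (v : 'rV[R]_m) :
  tailv (consv x v) = v.
Proof. by apply/rowP => j; rewrite !mxE liftK. Qed.

Lemma consv0 (R : realType) (m : nat) (x : R) (v : 'rV[R]_m) :
  consv x v 0 0 = x.
Proof. by rewrite mxE (unlift_none ord0). Qed.

Lemma consv_tailv (R : realType) (m : nat) (w : 'rV[R]_m.+1) :
  consv (w 0 0) (tailv w) = w.
Proof.
by apply/rowP => i; rewrite mxE; case: unliftP => [j|] ->; rewrite //= mxE.
Qed.

Lemma consvZ (R : realType) (m : nat) (s x : R) (v : 'rV[R]_m) :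
  s *: consv x v = consv (s * x) (s *: v).
Proof.
by apply/rowP => i; rewrite !mxE; case: unliftP => [j|] _; rewrite //= mxE.
Qed.

Lemma consvD (R : realType) (m : nat) (x y : R) (v w : 'rV[R]_m) :
  consv x v + consv y w = consv (x + y) (v + w).
Proof.
by apply/rowP => i; rewrite !mxE; case: unliftP => [j|] _; rewrite //= mxE.
Qed.

Lemma tailv_continuous (R : realType) (m : nat) : continuous (@tailv R m).
Proof.
apply: continuous_rV => j; rewrite (_ : (fun t => _) =
  (fun t : 'rV[R]_m.+1 => t 0 (lift ord0 j))).
  exact: coord_continuous.
by apply/funext => t; rewrite mxE.
Qed.

Lemma consv_continuous (R : realType) (m : nat) (T : topologicalType)
    (f : T -> R) (g : T -> 'rV[R]_m) :
  continuous f -> continuous g -> continuous (fun t => consv (f t) (g t)).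
Proof.
move=> cf cg; apply: continuous_rV => i; case: (unliftP ord0 i) => [j|] ->.
  rewrite (_ : (fun t => _) = (fun w : 'rV[R]_m => w 0 j) \o g).
    move=> t; apply: continuous_comp; first exact: cg.
    exact: coord_continuous.
  by apply/funext => t; rewrite mxE liftK.
rewrite (_ : (fun t => _) = f)//.
by apply/funext => t; rewrite consv0.
Qed.

Lemma le_vol (R : realType) (n : nat) (A B : set 'rV[R]_n) :
  vmeasurable A -> vmeasurable B -> A `<=` B -> (vol A <= vol B)%E.
Proof. by move=> mA mB AB; apply: le_measure; rewrite ?inE// => t; exact: AB. Qed.

Lemma vol_ge0 (R : realType) (n : nat) (A : set 'rV[R]_n) : (0 <= vol A)%E.
Proof. exact: measure_ge0. Qed.

(** * Volume under dilations *)

Definition dilate (R : realType) (n : nat) (s : R) (v x : 'rV[R]_n) := s *: x + v.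

Lemma dilate_continuous (R : realType) (n : nat) (s : R) (v : 'rV[R]_n) :
  continuous (dilate s v).
Proof.
move=> x; apply: (@continuousD _ _ _ ( *:%R s) (cst v)).
  exact: scaler_continuous.
exact: cst_continuous.
Qed.

Lemma compact_dilate (R : realType) (n : nat) (s : R) (v : 'rV[R]_n) A :
  compact A -> compact (dilate s v @` A).
Proof.
move=> cA; apply: continuous_compact => //.
by apply: continuous_subspaceT; exact: dilate_continuous.
Qed.

Lemma vol_dilate (R : realType) (n : nat) (s : R) (v : 'rV[R]_n) A :
  0 < s -> compact A -> vol (dilate s v @` A) = ((s ^+ n)%:E * vol A)%E.
Proof.
move=> s0 cA; rewrite /vol.
rewrite (lebesgue_tuple_affine [tuple (v 0 i : measurableTypeR R) | i < n] s0).
  set v' := mktuple _; congr (_ * lebesgue_tuple _)%E.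
  apply/funext => t; apply/propext.
  change ((dilate s v @` A) (rowt (taffine s v' t)) <-> A (rowt t)).
  have -> : rowt (taffine s v' t) = dilate s v (rowt t).
    by apply/rowP => i; rewrite !mxE !tnth_mktuple.
  split => [[x Ax]|At]; last by exists (rowt t).
  by move=> /addIr/(scalerI (lt0r_neq0 s0)) <-.
exact: (vmeasurable_compact (compact_dilate cA)).
Qed.

(** Admits the ratio 0, which occurs at the apex of the cone; the left side is then 0 because
    [0 < n]. *)
Lemma vol_dilate_ge (R : realType) (n : nat) (s : R) (v : 'rV[R]_n) A :
  (0 < n)%N -> 0 <= s -> compact A ->
  ((s ^+ n)%:E * vol A <= vol (dilate s v @` A))%E.
Proof.
move=> n0; rewrite le_eqVlt => /predU1P[<-|s0] cA; last by rewrite vol_dilate.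
by rewrite expr0n gtn_eqF// mul0e vol_ge0.
Qed.

(** * Widths and shadows *)

Section dotv.
Variables (R : realType) (n : nat).
Implicit Types x y z : 'rV[R]_n.

Lemma dotvC x y : dotv x y = dotv y x.
Proof. by apply: eq_bigr => i _; rewrite mulrC. Qed.

Lemma dotvDl x y z : dotv (x + y) z = dotv x z + dotv y z.
Proof. by rewrite -big_split; apply: eq_bigr => i _; rewrite mxE mulrDl. Qed.

Lemma dotvZl (a : R) x z : dotv (a *: x) z = a * dotv x z.
Proof. by rewrite mulr_sumr; apply: eq_bigr => i _; rewrite mxE mulrA. Qed.

Lemma dotvBl x y z : dotv (x - y) z = dotv x z - dotv y z.
Proof. by rewrite dotvDl -scaleN1r dotvZl mulN1r. Qed.

Lemma dotvZr (a : R) x z : dotv z (a *: x) = a * dotv z x.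
Proof. by rewrite !(dotvC z) dotvZl. Qed.

Lemma dotvBr x y z : dotv z (x - y) = dotv z x - dotv z y.
Proof. by rewrite !(dotvC z) dotvBl. Qed.

Lemma dotv_ge0 x : 0 <= dotv x x.
Proof. by apply: sumr_ge0 => i _; rewrite -expr2 sqr_ge0. Qed.

Lemma dotv_eq0 x : dotv x x = 0 -> x = 0.
Proof.
move=> /eqP; rewrite psumr_eq0 => [/allP x0|i _]; last by rewrite -expr2 sqr_ge0.
apply/rowP => i; rewrite mxE; apply/eqP.
by have := x0 i; rewrite mem_index_enum -expr2 sqrf_eq0; apply.
Qed.

Lemma dotv_sqrBZ t x y :
  dotv (x - t *: y) (x - t *: y) =
  dotv x x - t * dotv y x *+ 2 + t * (t * dotv y y).
Proof.
by rewrite !(dotvBl, dotvBr, dotvZl, dotvZr) (dotvC x y) mulr2n; ring.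
Qed.

Lemma dotv_delta i x : dotv x (delta_mx 0 i) = x 0 i.
Proof.
rewrite /dotv (bigD1 i)//= mxE !eqxx mulr1 big1 ?addr0// => j ji.
by rewrite mxE (negbTE ji) andbF mulr0.
Qed.

Lemma dotv_proj_hyper u x w : dotv u w = 0 ->
  dotv (proj_hyper u x) w = dotv x w.
Proof. by move=> uw; rewrite dotvBl dotvZl uw mulr0 subr0. Qed.
End dotv.

Lemma dotv_continuous (R : realType) (n : nat) (T : topologicalType)
    (f g : T -> 'rV[R]_n) :
  continuous f -> continuous g -> continuous (fun t => dotv (f t) (g t)).
Proof.
move=> cf cg; rewrite /dotv; elim: (index_enum _) => [|i s IH].
  by under [X in continuous X]funext do rewrite big_nil; exact: cst_continuous.
under [X in continuous X]funext do rewrite big_cons.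
have coord (h : T -> 'rV[R]_n) : continuous h -> continuous (fun t => h t 0 i).
  move=> ch t; apply: (@continuous_comp _ _ _ h (fun w : 'rV_n => w 0 i)).
    exact: ch.
  exact: coord_continuous.
move=> t; apply: cvgD; last exact: IH.
by apply: cvgM; exact: coord.
Qed.

Lemma unit_orthogonal (R : realType) (n : nat) (w : 'rV[R]_n) : (2 <= n)%N ->
  exists2 u : 'rV[R]_n, enorm u = 1 & dotv u w = 0.
Proof.
case: n w => [//|[//|n]] w _.
pose i0 : 'I_n.+2 := ord0; pose i1 : 'I_n.+2 := lift ord0 ord0.
pose e i : 'rV[R]_n.+2 := delta_mx 0 i.
(* A quarter turn of the first two coordinates of [w]. If it vanishes, so does [w 0 i0], and [e i0]
   itself is orthogonal to [w]. *)
pose u := w 0 i1 *: e i0 - w 0 i0 *: e i1.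
have [u0|u0] := eqVneq u 0.
  exists (e i0).
    by rewrite /enorm dotv_delta mxE !eqxx sqrtr1.
  rewrite dotvC dotv_delta; have := congr1 (fun v : 'rV_ _ => v 0 i1) u0.
  by rewrite !mxE /= mulr0 mulr1 sub0r => /eqP; rewrite oppr_eq0 => /eqP.
have nu0 : enorm u != 0.
  apply: contra u0 => /eqP nu0; apply/eqP/dotv_eq0/le_anti.
  by rewrite dotv_ge0 -sqrtr_eq0 -/(enorm u) nu0 eqxx.
exists ((enorm u)^-1 *: u).
  rewrite {1}/enorm dotvZl dotvZr mulrA -expr2 -(sqr_sqrtr (dotv_ge0 u)).
  by rewrite -/(enorm u) -exprMn mulVf// expr1n sqrtr1.
rewrite dotvZl dotvBl !dotvZl !(dotvC _ w) !dotv_delta.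
by rewrite [w 0 i0 * _]mulrC subrr mulr0.
Qed.

Lemma convex_set_comb (R : realType) (n : nat) (A : set 'rV[R]_n) (t : R) a b :
  convex_set A -> A a -> A b -> 0 <= t <= 1 -> A (t *: a + (1 - t) *: b).
Proof.
move=> cA Aa Ab /andP[t0 t1].
have := cA a b (Itv01 t0 t1); by rewrite !inE; apply.
Qed.

(* If [z] = [b - a] were not in [L - L], the direction [w] from the point of
   [L - L] nearest to [z] to [z] would separate them; a projection along some
   [u] orthogonal to [w] preserves widths in the direction [w]. *)
Lemma difference_body_subset (R : realType) (n : nat) (K L : set 'rV[R]_n) :
  (2 <= n)%N -> L !=set0 -> compact L -> convex_set L ->
  (forall u : 'rV[R]_n, enorm u = 1 ->
    contains_translate (shadow u L) (shadow u K)) ->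
  forall a b, K a -> K b -> exists c d, [/\ L c, L d & d - c = b - a].
Proof.
move=> n2 L0 cL convL shadows a b Ka Kb.
pose r (p : 'rV[R]_n * 'rV[R]_n) := b - a - (p.2 - p.1).
have cr : continuous r.
  move=> p; apply: cvgB; first exact: cst_continuous.
  by apply: cvgB; [exact: cvg_snd|exact: cvg_fst].
have [[c d] /set_mem[/= Lc Ld] rmin] : exists2 c, c \in L `*` L &
    forall t, t \in L `*` L -> dotv (r c) (r c) <= dotv (r t) (r t).
  apply: compact_EVT_min.
  - by have [x Lx] := L0; exists (x, x).
  - exact: compact_setX.
  - by apply: continuous_subspaceT; exact: dotv_continuous.
exists c, d; split => //; apply/esym/subr0_eq/dotv_eq0.
set w := b - a - (d - c).
(* Variational inequality at the nearest point: moving from [d - c] a fraction [t] of the way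
   towards [d' - c'] stays in L - L and changes [w] to [w - t *: q], which cannot be shorter than
   [w]. *)
have wmax c' d' : L c' -> L d' -> dotv (d' - c') w <= dotv (d - c) w.
  move=> Lc' Ld'; rewrite -subr_le0 -dotvBl; set q := _ - _.
  have wq t : 0 < t <= 1 -> dotv q w *+ 2 <= t * dotv q q.
    move=> /andP[t0 t1]; have t01 : 0 <= t <= 1 by rewrite ltW.
    have := rmin (t *: c' + (1 - t) *: c, t *: d' + (1 - t) *: d).
    rewrite inE => /(_ (conj (convex_set_comb convL Lc' Lc t01)
      (convex_set_comb convL Ld' Ld t01))).
    have -> : r (t *: c' + (1 - t) *: c, t *: d' + (1 - t) *: d) = w - t *: q.
      by apply/rowP => i; rewrite !mxE; ring.
    rewrite (_ : r (c, d) = w)// dotv_sqrBZ mulr2n => le_w.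
    rewrite -(ler_pM2l t0) mulr2n; lra.
  rewrite leNgt; apply/negP => q0.
  have := dotv_ge0 q; rewrite le_eqVlt => /predU1P[qq0|qq0].
    have := wq 1; rewrite -qq0 mulr0 ltr01 lexx => /(_ isT).
    by rewrite mulr2n; lra.
  (* With this [t] the right side of [wq] is at most [dotv q w], so [wq] contradicts
     [dotv q w > 0]. *)
  pose t := Num.min 1 (dotv q w / dotv q q).
  have t0 : 0 < t by rewrite lt_min ltr01 divr_gt0.
  have tq : t * dotv q q <= dotv q w.
    by rewrite -ler_pdivlMr// ge_min lexx orbT.
  have := wq t; rewrite t0 ge_min lexx => /(_ isT); rewrite mulr2n; lra.
have [u u1 uw] := unit_orthogonal w n2.
have [v Kv] := shadows u u1.
have [c' Lc' c'E] : shadow u L (proj_hyper u a + v).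
  by apply: Kv; exists (proj_hyper u a) => //; exists a.
have [d' Ld' d'E] : shadow u L (proj_hyper u b + v).
  by apply: Kv; exists (proj_hyper u b) => //; exists b.
(* Projecting along [u] preserves products with [w], and the translation [v] cancels in the
   difference. *)
have E : dotv (d' - c') w = dotv (b - a) w.
  rewrite dotvBl -(dotv_proj_hyper d' uw) -(dotv_proj_hyper c' uw) c'E d'E.
  rewrite (dotvDl (proj_hyper u b)) (dotvDl (proj_hyper u a)).
  by rewrite !dotv_proj_hyper// dotvBl; ring.
(* The squared length of [w] is the product of [(b - a) - (d - c)] with [w]; by [E] and [wmax] it is
   at most 0. *)
apply/le_anti; rewrite dotv_ge0 andbT {1}/w dotvBl subr_le0 -E.
exact: wmax.
Qed.

(** * Chords and cones *)

(** Pairs of points of K with equal tails form a compact set, on which the signed length is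
    continuous and attains its maximum. *)
Lemma longest_chord (R : realType) (m : nat) (K : set 'rV[R]_m.+1) :
  K !=set0 -> compact K ->
  exists a b, [/\ K a, K b, tailv a = tailv b &
    forall a' b', K a' -> K b' -> tailv a' = tailv b' ->
    b' 0 0 - a' 0 0 <= b 0 0 - a 0 0].
Proof.
move=> [x0 Kx0] cK.
pose S : set ('rV[R]_m.+1 * 'rV[R]_m.+1) :=
  (K `*` K) `&` (fun p => tailv p.1 - tailv p.2) @^-1` [set 0].
have cS : compact S.
  apply: compact_closedI; first exact: compact_setX.
  apply: closed_comp; last first.
    by apply: compact_closed; [exact: norm_hausdorff|exact: compact_set1].
  move=> p _; apply: cvgB.
    apply: (@continuous_comp _ _ _ fst (@tailv R m)); first exact: cvg_fst.
    exact: tailv_continuous.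
  apply: (@continuous_comp _ _ _ snd (@tailv R m)); first exact: cvg_snd.
  exact: tailv_continuous.
have [[a b] /set_mem[/= [Ka Kb] /subr0_eq tab] abmax] : exists2 c, c \in S &
    forall t, t \in S -> t.2 0 0 - t.1 0 0 <= c.2 0 0 - c.1 0 0.
  apply: (@compact_EVT_max _ _
    (fun t : 'rV[R]_m.+1 * 'rV[R]_m.+1 => t.2 0 0 - t.1 0 0)) => //.
    by exists (x0, x0); split => //=; rewrite subrr.
  apply: continuous_subspaceT => p; apply: cvgB.
    by apply: (@continuous_comp _ _ _ snd (fun w : 'rV[R]_m.+1 => w 0 0));
      [exact: cvg_snd|exact: coord_continuous].
  by apply: (@continuous_comp _ _ _ fst (fun w : 'rV[R]_m.+1 => w 0 0));
      [exact: cvg_fst|exact: coord_continuous].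
exists a, b; split => // a' b' Ka' Kb' tab'.
by apply: (abmax (a', b')); rewrite inE; split => //=; rewrite tab' subrr.
Qed.

(** A nonempty [S] lies in the segment from [inf S] to [inf S + D]. *)
Lemma lebesgue_measure_le_diam (R : realType) (D : R) (S : set R) :
  0 <= D -> measurable (S : set (measurableTypeR R)) ->
  (forall x y, S x -> S y -> y - x <= D) ->
  (lebesgue_measure (S : set (measurableTypeR R)) <= D%:E)%E.
Proof.
move=> D0 mS SD; have [->|/set0P[x0 Sx0]] := eqVneq S set0.
  by rewrite measure0.
have infS : has_inf S.
  by split; [exists x0|exists (x0 - D) => y Sy; have := SD _ _ Sy Sx0; lra].
have -> : D%:E = lebesgue_measure (`[inf S, inf S + D]%classic : set R).
  rewrite lebesgue_measure_itv/= lte_fin ltrDl.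
  case: ltP => [_|D0']; first by rewrite -EFinB addrAC subrr add0r.
  by congr EFin; apply/le_anti/andP.
apply: le_measure; rewrite ?inE//.
move=> y Sy /=; rewrite in_itv/= ge_inf//=; last by case: infS.
rewrite -lerBlDr; apply: lb_le_inf; first by exists x0.
by move=> z Sz; have := SD _ _ Sz Sy; lra.
Qed.

Lemma measurable_vsection (R : realType) (m : nat) (A : set 'rV[R]_m.+1)
    (t : m.-tuple (measurableTypeR R)) : vmeasurable A ->
  measurable [set x : measurableTypeR R | A (consv x (rowt t))].
Proof.
move=> /vmeasurable_tcons mA; have := measurable_ysection t mA.
by congr measurable; apply/funext => x; rewrite /ysection /mkset inE.
Qed.

Lemma measurable_hsection (R : realType) (m : nat) (A : set 'rV[R]_m.+1)
  (x : R) : vmeasurable A -> vmeasurable [set v | A (consv x v)].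
Proof.
move=> /vmeasurable_tcons mA.
have := measurable_xsection (x : measurableTypeR R) mA.
by congr measurable; apply/funext => t; rewrite /xsection /mkset inE.
Qed.

Lemma measurable_fun_vsection (R : realType) (m : nat) (A : set 'rV[R]_m.+1) :
  vmeasurable A -> measurable_fun setT (fun t : m.-tuple (measurableTypeR R) =>
    lebesgue_measure [set x : measurableTypeR R | A (consv x (rowt t))]).
Proof.
move=> /vmeasurable_tcons mA.
have := measurable_fun_ysection (@lebesgue_measure R) mA.
congr measurable_fun; apply/funext => t /=; congr lebesgue_measure.
by apply/funext => x; rewrite /ysection /mkset inE.
Qed.

Lemma measurable_fun_hsection (R : realType) (m : nat) (A : set 'rV[R]_m.+1) :
  vmeasurable A -> measurable_fun setT (fun x : measurableTypeR R =>
    vol [set v | A (consv (x : R) v)]).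
Proof.
move=> /vmeasurable_tcons mA.
have := measurable_fun_xsection (@lebesgue_tuple R m) mA.
congr measurable_fun; apply/funext => x /=; rewrite /vol; congr lebesgue_tuple.
by apply/funext => t; rewrite /xsection /mkset inE.
Qed.

Lemma compact_tailv (R : realType) (m : nat) (A : set 'rV[R]_m.+1) :
  compact A -> compact (@tailv R m @` A).
Proof.
move=> cA; apply: continuous_compact => //.
by apply: continuous_subspaceT; exact: tailv_continuous.
Qed.

(** Tonelli along the first axis: the fibre over a point of the projection has diameter at most [D],
    and every other fibre is empty. *)
Lemma vol_le_chord (R : realType) (m : nat) (K : set 'rV[R]_m.+1) (D : R) :
  compact K -> 0 <= D ->
  (forall a b, K a -> K b -> tailv a = tailv b -> b 0 0 - a 0 0 <= D) ->
  (vol K <= D%:E * vol (@tailv R m @` K))%E.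
Proof.
move=> cK D0 KD; have mK := vmeasurable_compact cK.
have mtK := vmeasurable_compact (compact_tailv cK).
pose P := [set t : m.-tuple (measurableTypeR R) | (@tailv R m @` K) (rowt t)].
have -> : vol (@tailv R m @` K) = (\int[@lebesgue_tuple R m]_t (\1_P t)%:E)%E.
  by rewrite integral_indic// setIT.
rewrite -ge0_integralZl//; last first.
  by apply/measurable_EFinP; exact: measurable_indic.
rewrite vol_ysection//; apply: ge0_le_integral => //.
- exact: measurable_fun_vsection.
- by apply: measurable_funeM; apply/measurable_EFinP; exact: measurable_indic.
move=> t _; rewrite indicE; have [tP|tP] := boolP (t \in P).
  rewrite mule1; apply: lebesgue_measure_le_diam => //.
    exact: measurable_vsection.
  by move=> x y Kx Ky; have := KD _ _ Kx Ky; rewrite !consvK !consv0; exact.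
rewrite mule0 (_ : mkset _ = set0) ?measure0//.
apply/seteqP; split => // x Kx; move: tP; rewrite notin_setE; apply.
by exists (consv x (rowt t)) => //; rewrite consvK.
Qed.

(** Source of the constant m + 1: the slice of the cone at height x is a copy of its base with ratio
    1 - x. *)
Lemma integral_onemXn (R : realType) (m : nat) :
  (\int[@lebesgue_measure R]_(x in `[0%R, 1%R]) ((1 - x) ^+ m)%:E =
   (m.+1%:R^-1)%:E)%E.
Proof.
have := @Rintegral_onemXn R m; rewrite /Rintegral => <-; rewrite fineK//.
apply: integrable_fin_num => //.
apply: continuous_compact_integrable; first exact: segment_compact.
by apply: continuous_subspaceT => x; exact: continuous_onemXn.
Qed.

(** The cone with base {0} x B and apex (1, y). Its first coordinate is the parameter s of the
    overview, not a coordinate along the chords of L. *)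
Definition cone (R : realType) (m : nat) (y : 'rV[R]_m) (B : set 'rV[R]_m) :
    set 'rV[R]_m.+1 :=
  (fun p : R * 'rV[R]_m => consv p.1 (dilate (1 - p.1) (p.1 *: y) p.2)) @`
    (`[0, 1] `*` B).

Lemma compact_cone (R : realType) (m : nat) (y : 'rV[R]_m) B :
  compact B -> compact (cone y B).
Proof.
move=> cB; apply: continuous_compact; last first.
  by apply: compact_setX => //; exact: segment_compact.
apply: continuous_subspaceT; apply: consv_continuous => p; first exact: cvg_fst.
apply: cvgD; apply: cvgZ; [|exact: cvg_snd|exact: cvg_fst|exact: cvg_cst].
by apply: cvgB; [exact: cvg_cst|exact: cvg_fst].
Qed.

(** Integrate over the height in [0, 1]: each slice contains the corresponding dilate of [B]. *)
Lemma vol_cone_ge (R : realType) (m : nat) (y : 'rV[R]_m) B :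
  (0 < m)%N -> compact B ->
  ((m.+1%:R^-1)%:E * vol B <= vol (cone y B))%E.
Proof.
move=> m0 cB; have mE := vmeasurable_compact (compact_cone (y := y) cB).
have m01 : measurable (`[0, 1]%classic : set (measurableTypeR R)).
  exact: measurable_itv.
have mf : measurable_fun (`[0, 1]%classic : set (measurableTypeR R))
    (fun x : measurableTypeR R => ((1 - x) ^+ m)%:E).
  apply/measurable_EFinP; apply: measurable_funX; apply: measurable_funB => //.
rewrite -integral_onemXn -ge0_integralZr//; last first.
  move=> x /=; rewrite in_itv/= lee_fin => /andP[_ x1].
  by rewrite exprn_ge0// subr_ge0.
rewrite vol_xsection.
apply: (@le_trans _ _ (\int[@lebesgue_measure R]_(x in `[0%R, 1%R])
    vol [set v | cone y B (consv (x : R) v)])%E).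
  apply: ge0_le_integral => //.
  - move=> x /=; rewrite in_itv/= => /andP[_ x1].
    by rewrite mule_ge0 ?vol_ge0// lee_fin exprn_ge0// subr_ge0.
  - by apply: emeasurable_funM => //; exact: measurable_cst.
  - apply: (measurable_funS measurableT) => //.
    exact: measurable_fun_hsection.
  move=> x /=; rewrite in_itv/= => /andP[x0 x1].
  apply: (le_trans (vol_dilate_ge (s := 1 - x) (x *: y) m0 _ cB)).
    by rewrite subr_ge0.
  apply: le_vol.
  - exact: (vmeasurable_compact (compact_dilate cB)).
  - exact: (measurable_hsection x mE).
  move=> _ [z Bz <-]; exists (x, z) => //; split => //=.
  by rewrite in_itv/= x0 x1.
by apply: ge0_subset_integral => //; exact: measurable_fun_hsection.
Qed.

Lemma cone_chord (R : realType) (m : nat) (L : set 'rV[R]_m.+1) c d :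
  convex_set L -> L c -> L d -> tailv c = tailv d ->
  forall s v, cone (tailv c) (@tailv R m @` L) (consv s v) ->
  0 <= s <= 1 /\ exists x, forall r, 0 <= r <= 1 ->
    L (consv (x + r * (s * (d 0 0 - c 0 0))) v).
Proof.
move=> convL Lc Ld cd s v [[s' _] [/= s01 [p Lp <-]]] svE.
have es : s' = s by rewrite -(consv0 s v) -svE consv0.
have ev : v = dilate (1 - s') (s' *: tailv c) (tailv p).
  by rewrite -(consvK s v) -svE consvK.
move: s01; rewrite in_itv/= es => s01; split => //.
(* The first coordinate of [s *: c + (1 - s) *: p]. Replacing [c] by the point
   [r *: d + (1 - r) *: c] of the chord moves it by [r * (s * (d 0 0 - c 0 0))] and keeps the
   tail. *)
exists (s * c 0 0 + (1 - s) * p 0 0) => r r01.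
have := convex_set_comb convL (convex_set_comb convL Ld Lc r01) Lp s01.
congr L; rewrite -[in LHS](consv_tailv c) -[in LHS](consv_tailv d).
rewrite -[in LHS](consv_tailv p) !consvZ !consvD !consvZ !consvD ev es -cd.
congr consv; first ring.
by apply/rowP => i; rewrite /dilate !mxE; ring.
Qed.

(** Fibrewise comparison: if the chord of L over a point has length l, every height s of the cone
    over that point satisfies 0 <= s <= l / D, so the fibre of the cone has length at most l / D. *)
Lemma vol_cone_le (R : realType) (m : nat) (L : set 'rV[R]_m.+1) c d :
  compact L -> convex_set L -> L c -> L d -> tailv c = tailv d ->
  0 <= d 0 0 - c 0 0 ->
  ((d 0 0 - c 0 0)%:E * vol (cone (tailv c) (@tailv R m @` L)) <= vol L)%E.
Proof.
move=> cL convL Lc Ld cd; set D := d 0 0 - c 0 0 => D0.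
have mE := vmeasurable_compact (compact_cone (y := tailv c) (compact_tailv cL)).
have mL := vmeasurable_compact cL.
rewrite (vol_ysection mE) (vol_ysection mL) -ge0_integralZl//; last first.
  exact: measurable_fun_vsection.
apply: ge0_le_integral => //.
- by move=> t _; rewrite mule_ge0.
- by apply: measurable_funeM; exact: measurable_fun_vsection.
- exact: measurable_fun_vsection.
move=> t _; set Es := mkset _; set Ls := mkset _.
have mLs : measurable Ls by exact: measurable_vsection.
have mEs : measurable Es by exact: measurable_vsection.
have sD s : Es s -> 0 <= s /\ ((s * D)%:E <= lebesgue_measure Ls)%E.
  move=> /(cone_chord convL Lc Ld cd)[/andP[s0 s1] [x xL]]; split => //.
  have -> : (s * D)%:E =
      lebesgue_measure (`[x, x + s * D]%classic : set (measurableTypeR R)).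
    rewrite lebesgue_measure_itv/= lte_fin ltrDl.
    case: ltP => [_|sD0]; first by rewrite -EFinB addrAC subrr add0r.
    by congr EFin; apply/le_anti; rewrite sD0 mulr_ge0.
  apply: le_measure; rewrite ?inE//.
  move=> z /=; rewrite in_itv/= => /andP[xz zx].
  (* A degenerate segment has no ratio [(z - x) / (s * D)] to use; its only point is reached with
     ratio 0. *)
  have [sD0|sD0] := eqVneq (s * D) 0.
    have -> : z = x + 0 * (s * D) by rewrite mul0r; lra.
    by apply: xL; rewrite lexx ler01.
  have sDp : 0 < s * D by rewrite lt_def sD0 mulr_ge0.
  have -> : z = x + (z - x) / (s * D) * (s * D) by rewrite divfK//; ring.
  apply: xL; apply/andP; split; first by rewrite divr_ge0 ?subr_ge0// ltW.
  by rewrite ler_pdivrMr// mul1r; lra.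
have [D00|Dn0] := eqVneq D 0; first by rewrite D00 mul0e.
have Dp : 0 < D by rewrite lt_def Dn0.
have l0 : (0 <= lebesgue_measure Ls)%E by exact: measure_ge0.
(* An infinite fibre of L makes the bound trivial; otherwise its length is a real [l] that can be
   divided by [D]. *)
case E : (lebesgue_measure Ls) l0 => [l| |]; rewrite ?leey ?leeNy_eq//.
rewrite lee_fin => l0.
have : (lebesgue_measure Es <=
    lebesgue_measure (`[0%R, (l / D)%R]%classic : set (measurableTypeR R)))%E.
  apply: le_measure; rewrite ?inE//.
  move=> s /sD[s0]; rewrite E lee_fin => sl.
  by rewrite /= in_itv/= s0 ler_pdivlMr.
rewrite lebesgue_measure_itv/= lte_fin => Esle.
have {}Esle : (lebesgue_measure Es <= (l / D)%:E)%E.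
  apply: (le_trans Esle); case: ifPn => _; first by rewrite -EFinB subr0.
  by rewrite lee_fin divr_ge0.
apply: (le_trans (lee_wpmul2l _ Esle)); first by rewrite lee_fin.
by rewrite -EFinM mulrC divfK.
Qed.

(** The two bounds on the volume of the cone over L' with apex over the chord, multiplied by m +
    1. *)
Lemma chord_shadow_vol (R : realType) (m : nat) (L : set 'rV[R]_m.+1) c d :
  (0 < m)%N -> compact L -> convex_set L -> L c -> L d -> tailv c = tailv d ->
  0 <= d 0 0 - c 0 0 ->
  ((d 0 0 - c 0 0)%:E * vol (@tailv R m @` L) <= m.+1%:R%:E * vol L)%E.
Proof.
move=> m0 cL convL Lc Ld cd D0.
apply: le_trans (lee_wpmul2l _ (vol_cone_le cL convL Lc Ld cd D0)); last first.
  by rewrite lee_fin.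
rewrite muleCA; apply: lee_wpmul2l; first by rewrite lee_fin.
have := lee_wpmul2l (x := m.+1%:R%:E) _
  (vol_cone_ge (tailv c) m0 (compact_tailv cL)).
rewrite lee_fin ler0n => /(_ isT); apply: le_trans.
by rewrite muleA -EFinM divff ?mul1e// pnatr_eq0.
Qed.

Theorem theorem8p1 (R : realType) (n : nat) (K L : set 'rV[R]_n)
  (n_ge2 : (2 <= n)%N)
  (K_nonempty : K !=set0) (K_compact : compact K) (K_convex : convex_set K)
  (L_nonempty : L !=set0) (L_compact : compact L) (L_convex : convex_set L)
  (shadows : forall u : 'rV[R]_n, enorm u = 1 ->
    contains_translate (shadow u L) (shadow u K)) :
  (vol K <= n%:R%:E * vol L)%E.
Proof.
case: n => [//|m] in K L n_ge2 K_nonempty K_compact K_convex L_nonempty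
  L_compact L_convex shadows *.
have [a [b [Ka Kb ab Kmax]]] := longest_chord K_nonempty K_compact.
have D0 : 0 <= b 0 0 - a 0 0 by rewrite -(subrr (a 0 0)); exact: Kmax.
have [c [d [Lc Ld cd]]] := difference_body_subset n_ge2 L_nonempty L_compact
  L_convex shadows Ka Kb.
(* Since [d - c = b - a] and [b - a] is parallel to the first axis, [c] and [d] span a chord of L of
   the same length. *)
have cdt : tailv c = tailv d.
  apply/rowP => i; have /rowP/(_ (lift ord0 i)) := cd.
  have /rowP/(_ i) := ab; rewrite !mxE => ->; rewrite subrr => /subr0_eq.
  exact: esym.
have cd0 : b 0 0 - a 0 0 = d 0 0 - c 0 0.
  by have /rowP/(_ 0) := cd; rewrite !mxE.
apply: (le_trans (vol_le_chord K_compact D0 Kmax)).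
(* The middle term is D vol L'; [2 <= m.+1] computes to the required [0 < m]. *)
apply: le_trans (chord_shadow_vol n_ge2 L_compact L_convex Lc Ld cdt _);
  last by rewrite -cd0.
rewrite -cd0; apply: lee_wpmul2l; first by rewrite lee_fin.
(* The shadow along the first axis has the same tails as the set, so the hypothesis places K'
   translated by [tailv v] inside L'. A translation is a dilation of ratio 1. *)
have [|v Kv] := shadows (delta_mx 0 0).
  by rewrite /enorm dotv_delta mxE !eqxx sqrtr1.
have cK' := compact_tailv K_compact; have cL' := compact_tailv L_compact.
have := vol_dilate (tailv v) ltr01 cK'.
rewrite expr1n mul1e => <-; apply: le_vol.
- exact: (vmeasurable_compact (compact_dilate cK')).
- exact: vmeasurable_compact.
have tailv_proj (x : 'rV[R]_m.+1) : tailv (proj_hyper (delta_mx 0 0) x) = tailv x.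
  by apply/rowP => i; rewrite !mxE /= mulr0 subr0.
move=> _ [_ [x Kx <-] <-].
have [z Lz zE] : shadow (delta_mx 0 0) L (proj_hyper (delta_mx 0 0) x + v).
  by apply: Kv; exists (proj_hyper (delta_mx 0 0) x) => //; exists x.
exists z => //; rewrite -tailv_proj zE -(tailv_proj x) /dilate scale1r.
by apply/rowP => i; rewrite !mxE.
Qed.
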